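(* Let $f\colon K\to L$ and $g\colon L\to M$ be simplicial maps between finite connected simplicial complexes. Then $$\mathrm{Es}(g\circ f)\geq (\mathrm{Es}(g)+1)(\mathrm{Es}(f)+1)-1.$$
   Context: Simplicial complexes are abstract, finite and (edge-path) connected; subcomplexes of a given complex (e.g. members of covers) are not required to be connected. A simplicial map $f\colon K\to L$ is a map of vertex sets sending simplices to simplices. Simplicial maps $f,g\colon K\to L$ are contiguous, $f\sim_c g$, if $f(\sigma)\cup g(\sigma)$ is a simplex of $L$ for every simplex $\sigma$ of $K$. They are in the same contiguity class, $f\sim g$, if there are simplicial maps $f=f_0\sim_c f_1\sim_c\cdots\sim_c f_m=g$ from $K$ to $L$. $f\sim *$ means $f\sim c$ for some map $c$ sending all vertices to a single vertex of $L$. For a complex $K$, $\mathrm{scat}(K)$ is the least integer $n\ge 0$ such that $K$ is a union of subcomplexes $U_0,\dots,U_n$ whose inclusions $i_{U_j}\colon U_j\to K$ satisfy $i_{U_j}\sim *$. A simplicial map $f\colon K\to L$ has essential simplicial category at least $n$ (for an integer $n\ge 0$), written $\mathrm{Es}(f)\ge n$, if for every simplicial complex $M$ with $\mathrm{scat}(M)\le n$ and every simplicial map $g\colon M\to K$ we have $f\circ g\sim *$. $\mathrm{Es}(f)\in\{0,1,2,\dots\}\cup\{\infty\}$ is the supremum of the $n$ with $\mathrm{Es}(f)\ge n$, with the usual conventions for $\infty$. *)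

(* Defs.v *)
From mathcomp Require Import all_boot all_order all_algebra.
From mathcomp Require Import boolp.
From Stdlib Require Import Relation_Operators.

Set Implicit Arguments.
Unset Strict Implicit.
Unset Printing Implicit Defensive.
Import Order.TTheory GRing.Theory Num.Theory.

Local Open Scope set_scope.

(* Finite abstract simplicial complexes, possibly disconnected or empty.
   Every element of [vert] is a vertex; the empty set is not a simplex. *)
Record scomplex := SComplex {
  vert : finType;
  simplex : {set {set vert}};
  simplex_neq0 : forall s, s \in simplex -> s != set0;
  simplex_vert : forall v, [set v] \in simplex;
  simplex_sub : forall s t : {set vert},
    s \in simplex -> t \subset s -> t != set0 -> t \in simplex
}.

Definition edge_rel (K : scomplex) : rel (vert K) :=
  fun u v => [set u; v] \in simplex K.

(* The empty complex does not count as connected. *)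
Definition edge_path_connected (K : scomplex) : Prop :=
  (0 < #|vert K|)%N /\ forall u v : vert K, connect (@edge_rel K) u v.

Record complex := Complex {
  scomplex_of :> scomplex;
  complex_connected : edge_path_connected scomplex_of
}.

Record smap (K L : scomplex) := SMap {
  sfun :> vert K -> vert L;
  smap_simplex : forall s, s \in simplex K -> sfun @: s \in simplex L
}.

Lemma scomp_simplex (K L M : scomplex) (g : smap L M) (f : smap K L) s :
  s \in simplex K -> (g \o f) @: s \in simplex M.
Proof. by move=> Ks; rewrite imset_comp; do 2 apply: smap_simplex. Qed.

Definition scomp (K L M : scomplex) (g : smap L M) (f : smap K L) :
  smap K M := SMap (scomp_simplex g f).

Lemma sconst_simplex (K L : scomplex) (v : vert L) s :
  s \in simplex K -> (fun _ : vert K => v) @: s \in simplex L.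
Proof.
move=> /simplex_neq0/set0Pn[x xs].
suff -> : (fun _ : vert K => v) @: s = [set v] by apply: simplex_vert.
apply/setP => y; rewrite inE; apply/imsetP/eqP => [[]//|->].
by exists x.
Qed.

Definition sconst (K L : scomplex) (v : vert L) : smap K L :=
  SMap (@sconst_simplex K L v).

Definition contiguous (K L : scomplex) (f g : smap K L) : Prop :=
  forall s, s \in simplex K -> (f @: s) :|: (g @: s) \in simplex L.

Definition contiguity_class (K L : scomplex) : smap K L -> smap K L -> Prop :=
  clos_refl_trans (smap K L) (@contiguous K L).

Definition null_class (K L : scomplex) (f : smap K L) : Prop :=
  exists v : vert L, contiguity_class f (sconst K v).

Record subcomplex (K : scomplex) := Subcomplex {
  faces : {set {set vert K}};
  faces_simplex : faces \subset simplex K;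
  faces_sub : forall s t : {set vert K},
    s \in faces -> t \subset s -> t != set0 -> t \in faces
}.

Section SubcomplexAsComplex.
Variables (K : scomplex) (U : subcomplex K).

Definition sub_vert : finType := {v : vert K | [set v] \in faces U}.

Definition sub_simplex : {set {set sub_vert}} :=
  [set s : {set sub_vert} | [set val x | x in s] \in faces U].

Lemma sub_simplex_neq0 s : s \in sub_simplex -> s != set0.
Proof.
rewrite inE => /(subsetP (faces_simplex U)) /simplex_neq0.
by apply: contraNneq => ->; rewrite imset0.
Qed.

Lemma sub_simplex_vert v : [set v] \in sub_simplex.
Proof. by rewrite inE imset_set1 (valP v). Qed.

Lemma sub_simplex_sub (s t : {set sub_vert}) :
  s \in sub_simplex -> t \subset s -> t != set0 -> t \in sub_simplex.
Proof.
rewrite !inE => Us ts t0; apply: faces_sub Us _ _; first exact: imsetS.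
by rewrite imset_eq0.
Qed.

Definition scomplex_of_sub : scomplex :=
  SComplex sub_simplex_neq0 sub_simplex_vert sub_simplex_sub.

Lemma sincl_simplex s :
  s \in simplex scomplex_of_sub ->
  (val : vert scomplex_of_sub -> vert K) @: s \in simplex K.
Proof. by rewrite inE => /(subsetP (faces_simplex U)). Qed.

Definition sincl : smap scomplex_of_sub K := SMap sincl_simplex.

End SubcomplexAsComplex.

Definition categorical_cover (K : scomplex) (n : nat) : Prop :=
  exists U : 'I_n.+1 -> subcomplex K,
    simplex K = \bigcup_(j < n.+1) faces (U j) /\
    forall j, null_class (sincl (U j)).

Section Facets.
Variables (K : scomplex) (s : {set vert K}).

Let F := [set t in simplex K | t \subset s].

Let F_simplex : F \subset simplex K.
Proof. by apply/subsetP => t; rewrite inE => /andP[]. Qed.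

Let F_sub (t u : {set vert K}) :
  t \in F -> u \subset t -> u != set0 -> u \in F.
Proof.
rewrite !inE => /andP[Kt ts] ut u0.
by rewrite (simplex_sub Kt ut u0) (subset_trans ut ts).
Qed.

Definition full_subcomplex : subcomplex K := Subcomplex F_simplex F_sub.

Lemma null_full_subcomplex : s \in simplex K -> null_class (sincl full_subcomplex).
Proof.
move=> Ks; have /set0Pn[v vs] := simplex_neq0 Ks.
exists v; apply: rt_step => t; rewrite inE /= => Ft.
have t0 : sval @: t != set0.
  by move: Ft; rewrite inE => /andP[/simplex_neq0].
apply: (simplex_sub Ks); last by rewrite setU_eq0 negb_and t0.
rewrite subUset; apply/andP; split.
  by move: Ft; rewrite inE => /andP[].
by apply/subsetP => _ /imsetP[y _ ->].
Qed.

End Facets.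

Lemma categorical_cover_exists (K : complex) :
  exists n, `[< categorical_cover K n >].
Proof.
have [/card_gt0P[v0 _] _] := complex_connected K.
pose e := enum (simplex K).
exists #|simplex K|; apply/asboolP.
exists (fun j => full_subcomplex (nth [set v0] e j)); split; last first.
  move=> j; apply: null_full_subcomplex.
  case: (ltnP j (size e)) => je; last by rewrite nth_default// simplex_vert.
  by rewrite -mem_enum mem_nth.
apply/setP => s; apply/idP/bigcupP => [Ks|[j _]]; last by rewrite inE => /andP[].
have ke : (index s e < #|simplex K|.+1)%N by rewrite ltnS cardE index_size.
exists (Ordinal ke) => //.
by rewrite inE Ks /= nth_index ?subxx// mem_enum.
Qed.

Definition scat (K : complex) : nat := ex_minn (categorical_cover_exists K).

Definition Es_ge (K L : complex) (f : smap K L) (n : nat) : Prop :=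
  forall (M : complex) (g : smap M K), (scat M <= n)%N -> null_class (scomp f g).

(* Imported only here: [set0], [subsetP] and others above are the finite-set
   ones, which classical_sets shadows. *)
From mathcomp Require Import classical_sets reals ereal.

(* The value lies in {0, 1, 2, ...} together with +oo, viewed inside the
   extended reals; the set is never empty because [Es_ge f 0] always holds. *)
Definition Es (R : realType) (K L : complex) (f : smap K L) : \bar R :=
  ereal_sup [set (n%:R)%:E | n in [set n : nat | Es_ge f n]]%classic.

(* Main.v *)
(* If [phi : P -> L] is null on each of n + 1 subcomplexes [A j] covering [P],
   then [phi] factors through a complex [Q] with [scat Q <= n]: glue to [P] a
   long cylinder on each [A j], with one common cone point at the far ends.
   The null homotopies extend [phi] to [Q] (they can all be made to end at the
   same vertex because [L] is connected), and the n + 1 cones cover [Q] and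
   contract to the cone point. Hence [g \o phi] is null when [Es g >= n].
   Given a categorical cover of [P] by (n + 1)(m + 1) subcomplexes, group them
   into n + 1 unions of m + 1 members each; the principle applied to [f] on each
   union, then to [g] on [P], shows that the composite is null. *)

Require Import Defs.
From mathcomp Require Import all_boot all_order all_algebra.
From mathcomp Require Import boolp zify reals ereal.
From Stdlib Require Import Relation_Operators.

Set Implicit Arguments.
Unset Strict Implicit.
Unset Printing Implicit Defensive.

Local Open Scope set_scope.

(** * Contiguity classes and null maps under composition *)

Lemma contiguous_eqfun (K L : scomplex) (f g : smap K L) :
  f =1 g -> contiguous f g.
Proof. by move=> fg s Ks; rewrite (eq_imset s fg) setUid smap_simplex. Qed.

Lemma contiguous_sym (K L : scomplex) (f g : smap K L) :
  contiguous f g -> contiguous g f.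
Proof. by move=> fg s Ks; rewrite setUC fg. Qed.

Lemma imset_scomp (K L M : scomplex) (g : smap L M) (f : smap K L)
    (s : {set vert K}) : scomp g f @: s = g @: (f @: s).
Proof. exact: imset_comp. Qed.

Lemma contiguous_compr (K L M : scomplex) (f g : smap L M) (h : smap K L) :
  contiguous f g -> contiguous (scomp f h) (scomp g h).
Proof. by move=> fg s Ks; rewrite !imset_scomp; exact/fg/smap_simplex. Qed.

Lemma contiguous_compl (K L M : scomplex) (f g : smap K L) (h : smap L M) :
  contiguous f g -> contiguous (scomp h f) (scomp h g).
Proof.
by move=> fg s Ks; rewrite !imset_scomp -imsetU; exact/smap_simplex/fg.
Qed.

Lemma contiguity_class_map (K L K' L' : scomplex)
    (F : smap K L -> smap K' L') :
  (forall f g, contiguous f g -> contiguous (F f) (F g)) ->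
  forall f g, contiguity_class f g -> contiguity_class (F f) (F g).
Proof.
move=> hF f g; elim=> [f1 f2 /hF|f1|f1 f2 f3 _ h1 _ h2].
- exact: rt_step.
- exact: rt_refl.
- exact: rt_trans h1 h2.
Qed.

Lemma contiguity_class_chain (K L : scomplex) (F : nat -> smap K L) n :
  (forall k, contiguous (F k) (F k.+1)) -> contiguity_class (F 0) (F n).
Proof.
move=> hF; elim: n => [|n IH]; first exact: rt_refl.
exact: rt_trans IH (rt_step _ _ _ _ (hF n)).
Qed.

(** The stationary tail allows finitely many chains of different lengths to be run over one common
    length. *)
Lemma contiguity_class_path (K L : scomplex) (f g : smap K L) :
  contiguity_class f g ->
  exists (m : nat) (G : nat -> smap K L), [/\ G 0 = f,
    forall i, (m <= i)%N -> G i = g & forall i, contiguous (G i) (G i.+1)].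
Proof.
elim=> [f1 f2 f12|f1|f1 f2 f3 _ [m [G [G0 Gm Gc]]] _ [p [H [H0 Hp Hc]]]].
- exists 1, (fun i => if i is 0 then f1 else f2).
  by split=> [//|[]//|[|i]//]; apply: contiguous_eqfun.
- by exists 0, (fun=> f1); split=> // i; apply: contiguous_eqfun.
- exists (m + p)%N, (fun i => if (i < m)%N then G i else H (i - m)%N); split.
  + by case: m Gm => [Gm|//]; rewrite ltnn H0 -(Gm 0).
  + move=> i mpi; rewrite ltnNge (leq_trans (leq_addr _ _) mpi) /=.
    by apply: Hp; rewrite leq_subRL ?(leq_trans (leq_addr _ _) mpi).
  + move=> i; case: (ltngtP i.+1 m) => [im|im|im].
    * exact: Gc.
    * by rewrite subSn; first exact: Hc.
    * by rewrite im subnn H0 -(Gm m) // -im; exact: Gc.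
Qed.

Lemma null_class_eqfun (K L : scomplex) (f g : smap K L) :
  f =1 g -> null_class f -> null_class g.
Proof.
move=> fg [v fv]; exists v; apply: rt_trans fv.
by apply/rt_step/contiguous_sym/contiguous_eqfun.
Qed.

Lemma null_class_compr (K L M : scomplex) (f : smap L M) (h : smap K L) :
  null_class f -> null_class (scomp f h).
Proof.
case=> v fv; exists v.
have cv : contiguous (scomp (sconst L v) h) (sconst K v).
  exact: contiguous_eqfun.
apply: rt_trans (rt_step _ _ _ _ cv).
apply: (contiguity_class_map (F := fun f' => scomp f' h)) fv => f1 f2.
exact: contiguous_compr.
Qed.

Lemma null_class_compl (K L M : scomplex) (f : smap K L) (h : smap L M) :
  null_class f -> null_class (scomp h f).
Proof.
case=> v fv; exists (h v).
have cv : contiguous (scomp h (sconst K v)) (sconst K (h v)).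
  exact: contiguous_eqfun.
apply: rt_trans (rt_step _ _ _ _ cv).
apply: (contiguity_class_map (F := scomp h)) fv => f1 f2.
exact: contiguous_compl.
Qed.

Lemma sconst_contiguity_class (K : scomplex) (L : complex) (u v : vert L) :
  contiguity_class (sconst K u) (sconst K v).
Proof.
have [_ /(_ u v)/connectP[p]] := complex_connected L.
elim: p u => [|w p IH] u /=; first by move=> _ ->; exact: rt_refl.
move=> /andP[uw wp] vE; apply: rt_trans (IH _ wp vE); apply: rt_step => s Ks.
have /set0Pn[x xs] := simplex_neq0 Ks.
suff cE (y : vert L) : sconst K y @: s = [set y] by rewrite !cE.
apply/setP => z; rewrite inE; apply/imsetP/eqP => [[]//|->].
by exists x.
Qed.

Lemma null_class_const (K : scomplex) (L : complex) (f : smap K L) (w : vert L) :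
  null_class f -> contiguity_class f (sconst K w).
Proof. by case=> v fv; apply: rt_trans fv (sconst_contiguity_class _ _ _). Qed.

(** * The cylinders over a cover, coned off at one point *)

Section Cylinder.
Variables (P : scomplex) (n : nat) (A : 'I_n.+1 -> scomplex).
Variables (a : forall j, smap (A j) P) (m : nat).
Variable v0 : vert P.
Hypothesis a_inj : forall j, injective (a j).
Hypothesis a_cover :
  forall s, s \in simplex P ->
    exists j, exists2 t, t \in simplex (A j) & s = a j @: t.

(* [inl v] is a vertex of the base [P], [inr (y, l)] is the copy of [y] at level
   [l + 1] of its cylinder, and [None] is the cone point, which serves as level
   [m + 1]; level 0 of every cylinder is identified with its image in [P]. *)
Definition cyl_vert : finType :=
  option (vert P + {j : 'I_n.+1 & vert (A j)} * 'I_m).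

Definition level j (i : nat) (x : vert (A j)) : cyl_vert :=
  if i is k.+1 then
    omap (fun l => inr (Tagged (fun j => vert (A j)) x, l)) (insub k : option 'I_m)
  else Some (inl (a j x)).

(** The full join of two consecutive copies of [s], not a triangulated prism: a map is simplicial on
    it exactly when its restrictions to the two levels satisfy the contiguity condition at [s]. *)
Definition block j i (s : {set vert (A j)}) : {set cyl_vert} :=
  level i @: s :|: level i.+1 @: s.

Definition cyl_piece j : {set {set cyl_vert}} :=
  [set u | (u != set0) && [exists s in simplex (A j),
    exists i : 'I_m.+1, u \subset block i s]].

Lemma level_ge j i (x : vert (A j)) : (m < i)%N -> level i x = None.
Proof. by case: i => // i mi; rewrite /level insubF //= ltnNge -ltnS mi. Qed.

Lemma cyl_pieceP j u :
  reflect (u != set0 /\ exists i s, s \in simplex (A j) /\ u \subset block i s)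
          (u \in cyl_piece j).
Proof.
rewrite inE; apply: (iffP andP) => [[u0 /exists_inP[s As /existsP[i us]]]|].
  by split=> //; exists i, s.
move=> [u0 [i [s [As us]]]]; split=> //; apply/exists_inP; exists s => //.
have [im|mi] := leqP i m; first by apply/existsP; exists (Ordinal (im : i < m.+1)%N).
apply/existsP; exists ord_max; apply: (subset_trans us).
rewrite subUset; apply/andP; split; apply/subsetP => _ /imsetP[x xs ->];
  rewrite inE; apply/orP; right; apply/imsetP; exists x => //;
  by rewrite !level_ge // ltnW.
Qed.

Lemma cyl_piece_sub j (s t : {set cyl_vert}) :
  s \in cyl_piece j -> t \subset s -> t != set0 -> t \in cyl_piece j.
Proof.
move=> /cyl_pieceP[_ [i [u [Au su]]]] ts t0; apply/cyl_pieceP; split=> //.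
by exists i, u; split=> //; exact: subset_trans su.
Qed.

Definition cyl_simplex : {set {set cyl_vert}} :=
  \bigcup_j cyl_piece j.

Lemma cyl_edge j i (x : vert (A j)) :
  [set level i x; level i.+1 x] \in cyl_piece j.
Proof.
apply/cyl_pieceP; split; first by apply/set0Pn; exists (level i x); rewrite set21.
exists i, [set x]; split; first exact: simplex_vert.
by rewrite /block !imset_set1.
Qed.

Lemma a_surj (v : vert P) : exists j, exists x : vert (A j), a j x = v.
Proof.
have [j [s As vE]] := a_cover (simplex_vert v).
have /imsetP[x _ ->] : v \in a j @: s by rewrite -vE set11.
by exists j, x.
Qed.

Lemma cyl_levelP (v : cyl_vert) : exists j i, exists x : vert (A j), v = level i x.
Proof.
case: v => [[v|[[j x] l]]|].
- by have [j [x <-]] := a_surj v; exists j, 0, x.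
- by exists j, l.+1, x; rewrite /level valK.
(* The cone point lies over some vertex because [P] is nonempty, as witnessed by [v0]. *)
- by have [j [x _]] := a_surj v0; exists j, m.+1, x; rewrite level_ge.
Qed.

Lemma cyl_simplex_neq0 s : s \in cyl_simplex -> s != set0.
Proof. by move=> /bigcupP[j _ /cyl_pieceP[]]. Qed.

Lemma cyl_simplex_vert v : [set v] \in cyl_simplex.
Proof.
have [j [i [x ->]]] := cyl_levelP v; apply/bigcupP; exists j => //.
apply: cyl_piece_sub (cyl_edge i x) _ _; first by rewrite sub1set set21.
by apply/set0Pn; exists (level i x); rewrite set11.
Qed.

Lemma cyl_simplex_sub (s t : {set cyl_vert}) :
  s \in cyl_simplex -> t \subset s -> t != set0 -> t \in cyl_simplex.
Proof.
move=> /bigcupP[j _ js] ts t0; apply/bigcupP; exists j => //.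
exact: cyl_piece_sub js ts t0.
Qed.

Definition cyl_scomplex : scomplex :=
  SComplex cyl_simplex_neq0 cyl_simplex_vert cyl_simplex_sub.

Lemma cyl_connected : edge_path_connected cyl_scomplex.
Proof.
split; first by apply/card_gt0P; exists None.
have sym : connect_sym (@edge_rel cyl_scomplex).
  by apply: sym_connect_sym => u v; rewrite /edge_rel setUC.
suff toN v : connect (@edge_rel cyl_scomplex) v None.
  by move=> u v; apply: connect_trans (toN u) _; rewrite sym.
have [j [i [x ->]]] := cyl_levelP v.
(* Climbing [m.+1] levels reaches the cone point from any starting level. *)
suff up k : connect (@edge_rel cyl_scomplex) (level i x) (level (i + k) x).
  by have := up m.+1; rewrite [X in connect _ _ X]level_ge // ltn_addl.
elim: k => [|k IH]; first by rewrite addn0.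
apply: connect_trans IH (connect1 _); rewrite addnS /edge_rel.
by apply/bigcupP; exists j => //; exact: cyl_edge.
Qed.

Definition cyl : complex := Complex cyl_connected.

Lemma cyl_piece_simplex j : cyl_piece j \subset simplex cyl.
Proof. by apply/subsetP => s js; apply/bigcupP; exists j. Qed.

Definition cyl_part j : subcomplex cyl :=
  @Subcomplex cyl (cyl_piece j) (cyl_piece_simplex j) (@cyl_piece_sub j).

Lemma cyl_base_simplex s :
  s \in simplex P -> (Some \o inl : vert P -> vert cyl) @: s \in simplex cyl.
Proof.
move=> Ps; have [j [t At sE]] := a_cover Ps.
apply/bigcupP; exists j => //; apply/cyl_pieceP; split.
  by rewrite imset_eq0 (simplex_neq0 Ps).
exists 0, t; split=> //; rewrite sE -imset_comp; exact: subsetUl.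
Qed.

Definition cyl_base : smap P cyl := SMap cyl_base_simplex.

(* The retraction of the [j]-th cone onto the part above level [k]. *)
Definition push j k (v : cyl_vert) : cyl_vert :=
  match v with
  | Some (inl u) => if [pick x | a j x == u] is Some x then level k x else None
  | Some (inr (y, l)) => level (maxn k l.+1) (tagged y)
  | None => None
  end.

(** Injectivity of [a j] makes the [pick] in [push] return [x] itself at level 0. *)
Lemma push_level j k i (x : vert (A j)) : push j k (level i x) = level (maxn k i) x.
Proof.
case: i => [|i] /=.
  rewrite maxn0; case: pickP => [y /eqP/a_inj -> //|/(_ x)].
  by rewrite eqxx.
case: insubP => [l _ <- //|im] /=.
by rewrite level_ge // leq_max ltnS (leqNgt m i) im orbT.
Qed.

(** Pushing levels [i] and [i.+1] to [k] or [k.+1] only produces the levels [maxn k i] and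
    [(maxn k i).+1], so one block contains both images. This is the contiguity of successive
    pushes. *)
Lemma push_piece j k s : s \in cyl_piece j ->
  push j k @: s :|: push j k.+1 @: s \in cyl_piece j.
Proof.
move=> /cyl_pieceP[s0 [i [t [At st]]]]; apply/cyl_pieceP; split.
  by rewrite setU_eq0 negb_and imset_eq0 s0.
exists (maxn k i), t; split=> //.
have lvl e x : x \in t -> (maxn k i <= e <= (maxn k i).+1)%N ->
    level e x \in block (maxn k i) t.
  move=> xt /andP[]; rewrite leq_eqVlt => /orP[/eqP<- _|ke ek].
    by rewrite inE; apply/orP; left; apply: imset_f.
  have -> : e = (maxn k i).+1 by apply/eqP; rewrite eqn_leq ek ke.
  by rewrite inE; apply/orP; right; apply: imset_f.
rewrite subUset; apply/andP; split; apply/subsetP => _ /imsetP[v vs ->];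
  have := subsetP st v vs; rewrite inE => /orP[] /imsetP[x xt ->];
  rewrite push_level; apply: lvl => //; lia.
Qed.

Lemma push_simplex j k (s : {set vert (scomplex_of_sub (cyl_part j))}) :
  s \in simplex (scomplex_of_sub (cyl_part j)) ->
  (fun v : vert (scomplex_of_sub (cyl_part j)) => push j k (val v) : vert cyl) @: s
    \in simplex cyl.
Proof.
rewrite inE => js; rewrite (imset_comp (push j k) val).
apply: simplex_sub (subsetP (cyl_piece_simplex j) _ (push_piece k js)) _ _.
  exact: subsetUl.
by rewrite imset_eq0; case/cyl_pieceP: js.
Qed.

Definition push_smap j k : smap (scomplex_of_sub (cyl_part j)) cyl :=
  SMap (@push_simplex j k).

Lemma cyl_part_null j : null_class (sincl (cyl_part j)).
Proof.
exists (None : vert cyl).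
have vlevel (v : vert (scomplex_of_sub (cyl_part j))) :
    exists i, exists x : vert (A j), val v = level i x.
  have /cyl_pieceP[_ [i [t [_]]]] := valP v.
  by rewrite sub1set inE => /orP[]/imsetP[x _ ->]; [exists i, x|exists i.+1, x].
(* The chain of pushes runs from [push j 0], which is the inclusion, to [push j m.+1], which is
   constant at the cone point. *)
apply: (@rt_trans _ _ _ (push_smap j 0)); last first.
  apply: (@rt_trans _ _ _ (push_smap j m.+1)).
    apply: contiguity_class_chain => k s; rewrite inE => js.
    rewrite /= !(imset_comp (push j _) val).
    exact: subsetP (cyl_piece_simplex j) _ (push_piece k js).
  apply/rt_step/contiguous_eqfun => v /=; have [i [x ->]] := vlevel v.
  by rewrite push_level level_ge // leq_max ltnSn.
apply/rt_step/contiguous_eqfun => v /=; have [i [x ->]] := vlevel v.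
by rewrite push_level max0n.
Qed.

Lemma scat_cyl : (scat cyl <= n)%N.
Proof.
rewrite /scat; case: ex_minnP => k _; apply; apply/asboolP.
by exists cyl_part; split=> //; exact: cyl_part_null.
Qed.

Section Extension.
Variables (L : scomplex) (phi : smap P L) (w : vert L).
Variable G : forall j, nat -> smap (A j) L.
Hypothesis G0 : forall j, G j 0 =1 scomp phi (a j).
Hypothesis Gm : forall j i, (m < i)%N -> G j i =1 sconst (A j) w.
Hypothesis Gc : forall j i, contiguous (G j i) (G j i.+1).

Definition extend (v : vert cyl) : vert L :=
  match v with
  | Some (inl u) => phi u
  | Some (inr (y, l)) => G (tag y) l.+1 (tagged y)
  | None => w
  end.

Lemma extend_level j i (x : vert (A j)) : extend (level i x) = G j i x.
Proof.
case: i => [|i] /=; first by rewrite G0.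
by case: insubP => [l _ <- //|im] /=; rewrite Gm // ltnS leqNgt.
Qed.

(** A block at level [i] over [t] maps onto the union of the images of [t] under [G j i] and
    [G j i.+1], a simplex by contiguity. *)
Lemma extend_simplex s : s \in simplex cyl -> extend @: s \in simplex L.
Proof.
move=> /bigcupP[j _ /cyl_pieceP[s0 [i [t [At st]]]]].
apply: (simplex_sub (Gc i At)); last by rewrite imset_eq0.
apply: subset_trans (imsetS _ st) _; rewrite imsetU -!imset_comp.
by rewrite !(eq_imset _ (@extend_level j _)).
Qed.

Definition cyl_extend : smap cyl L := SMap extend_simplex.

End Extension.

End Cylinder.

(** The pieces are complexes with injective maps to [P], not subcomplexes of [P], so that
    subcomplexes of an ambient complex can also serve as pieces of a smaller union. *)
Lemma null_class_cover (P : scomplex) (n : nat) (A : 'I_n.+1 -> scomplex)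
    (a : forall j, smap (A j) P) (L M : complex) (phi : smap P L) (g : smap L M) :
  (forall j, injective (a j)) ->
  (forall s, s \in simplex P ->
    exists j, exists2 t, t \in simplex (A j) & s = a j @: t) ->
  (forall j, null_class (scomp phi (a j))) ->
  Es_ge g n -> null_class (scomp g phi).
Proof.
move=> a_inj a_cover phi_null g_n.
have [/card_gt0P[w _] _] := complex_connected L.
(* [P] may be empty, and then every map out of it is vacuously contiguous to a constant. *)
have [v0|P0] := pselect (exists v0 : vert P, true); last first.
  exists (g w); apply: rt_step => s /simplex_neq0/set0Pn[x _].
  by case: P0; exists x.
case: v0 => v0 _.
have path j := cid (contiguity_class_path (null_class_const w (phi_null j))).
pose m j := sval (path j).
have pathG j := cid (svalP (path j)).
pose G j := sval (pathG j).
have hG j : [/\ G j 0 = scomp phi (a j),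
    forall i, (m j <= i)%N -> G j i = sconst (A j) w
    & forall i, contiguous (G j i) (G j i.+1)] := svalP (pathG j).
(* The longest of the null homotopies fixes the common length of the cylinders. *)
have mG j i : ((\max_j m j) < i)%N -> G j i =1 sconst (A j) w.
  by have [_ Gm _] := hG j => mi x; rewrite Gm // (leq_trans _ (ltnW mi)) ?leq_bigmax.
have G0 j : G j 0 =1 scomp phi (a j) by have [-> _ _] := hG j.
have Gc j i : contiguous (G j i) (G j i.+1) by have [_ _ +] := hG j; apply.
have := g_n _ (cyl_extend v0 a_cover G0 mG Gc) (scat_cyl (\max_j m j) v0 a_inj a_cover).
move/(null_class_compr (cyl_base (\max_j m j) v0 a_cover)).
exact: null_class_eqfun.
Qed.

(** * Maps into subcomplexes and the inequality at finite levels *)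

Section Lift.
Variables (K L : scomplex) (f : smap K L) (U : subcomplex L).
Hypothesis fU : forall s, s \in simplex K -> f @: s \in faces U.

Lemma lift_vert v : [set f v] \in faces U.
Proof. by rewrite -imset_set1 fU // simplex_vert. Qed.

Definition lift_fun (v : vert K) : vert (scomplex_of_sub U) :=
  exist _ (f v) (lift_vert v).

Lemma lift_simplex s : s \in simplex K -> lift_fun @: s \in simplex (scomplex_of_sub U).
Proof. by move=> Ks; rewrite inE -imset_comp; exact: fU. Qed.

Definition lift : smap K (scomplex_of_sub U) := SMap lift_simplex.

End Lift.

Lemma sub_simplex_preim (K : scomplex) (U : subcomplex K) s :
  s \in faces U ->
  exists2 t, t \in simplex (scomplex_of_sub U) & s = sincl U @: t.
Proof.
move=> Us.
have sE : s = sincl U @: (val @^-1: s).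
  apply/setP => x; apply/idP/imsetP => [xs|[y]]; last by rewrite inE => ys ->.
  have Ux : [set x] \in faces U.
    by apply: faces_sub Us _ _; rewrite ?sub1set //; apply/set0Pn; exists x; rewrite set11.
  by exists (exist _ x Ux); rewrite ?inE.
by exists (val @^-1: s) => //; rewrite inE; move: Us; rewrite {1}sE.
Qed.

Lemma Es_ge_comp (K L M : complex) (f : smap K L) (g : smap L M) m n :
  Es_ge f m -> Es_ge g n -> Es_ge (scomp g f) (n.+1 * m.+1).-1.
Proof.
move=> f_m g_n P h; rewrite /scat; case: ex_minnP => k /asboolP[U [PU U_null]] _ kmn.
have {}kmn : (k < n.+1 * m.+1)%N by rewrite mulSn addSn ltnS in kmn *.
(* Group [j] consists of [m.+1] consecutive members. Indices beyond [k] default to 0 under [inord],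
   which merely repeats [U ord0]. *)
pose W (j : 'I_n.+1) (i : 'I_m.+1) := U (inord (j * m.+1 + i)).
have VP j : \bigcup_i faces (W j i) \subset simplex P.
  by apply/bigcupsP => i _; exact: faces_simplex.
have Vsub j (s t : {set vert P}) : s \in \bigcup_i faces (W j i) ->
    t \subset s -> t != set0 -> t \in \bigcup_i faces (W j i).
  move=> /bigcupP[i _ si] ts t0; apply/bigcupP; exists i => //.
  exact: faces_sub si ts t0.
pose V j := Subcomplex (VP j) (Vsub j).
have Vlift j i s : s \in simplex (scomplex_of_sub (W j i)) ->
    sincl (W j i) @: s \in faces (V j).
  by rewrite inE => Ws; apply/bigcupP; exists i.
apply: (null_class_eqfun (f := scomp g (scomp f h))) => //.
apply: (null_class_cover (a := fun j => sincl (V j))) g_n.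
- by move=> j; exact: val_inj.
- rewrite PU => s /bigcupP[l _ sl].
  (* Euclidean division of [l] by [m.+1] gives its group and its position there. *)
  have lm : (l %/ m.+1 < n.+1)%N by rewrite ltn_divLR // (leq_ltn_trans _ kmn) // -ltnS.
  exists (Ordinal lm); apply: sub_simplex_preim; apply/bigcupP.
  exists (Ordinal (ltn_pmod l (ltn0Sn m))) => //.
  by rewrite /W /= -divn_eq inord_val.
move=> j; apply: (null_class_eqfun (f := scomp f (scomp h (sincl (V j))))) => //.
apply: (null_class_cover (a := fun i => lift (@Vlift j i))) f_m.
- by move=> i x y [/val_inj].
- move=> s; rewrite inE => /bigcupP[i _ /sub_simplex_preim[t Wt stE]].
  exists i, t => //; apply: (imset_inj val_inj).
  by rewrite stE -[in RHS]imset_comp.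
move=> i; apply: (null_class_eqfun (f := scomp h (sincl (W j i)))) => //.
exact/null_class_compl/U_null.
Qed.

(** When [scat M] is 0, a single member covers [M], so the identity of [M] factors through a null
    inclusion. *)
Lemma Es_ge0 (K L : complex) (f : smap K L) : Es_ge f 0.
Proof.
move=> M g; rewrite /scat; case: ex_minnP => k /asboolP[U [MU U_null]] _.
rewrite leqn0 => /eqP k0; subst k.
have idM s : s \in simplex M -> id @: s \in simplex M by rewrite imset_id.
have idU s : s \in simplex M -> SMap idM @: s \in faces (U ord0).
  by rewrite MU imset_id big_ord1.
have := null_class_compl (scomp f g) (null_class_compr (lift idU) (U_null ord0)).
exact: null_class_eqfun.
Qed.

Lemma Es_ge_le (K L : complex) (f : smap K L) m n :
  (m <= n)%N -> Es_ge f n -> Es_ge f m.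
Proof. by move=> mn fn M h hM; apply: fn; exact: leq_trans mn. Qed.

(* Passage to the extended reals *)
From mathcomp Require Import classical_sets.
Import Order.TTheory GRing.Theory Num.Theory.
Local Open Scope ring_scope.
Local Open Scope ereal_scope.

Lemma Es_ge_Es (R : realType) (K L : complex) (f : smap K L) n :
  Es_ge f n -> (n%:R)%:E <= Es R f.
Proof. by move=> fn; apply: ereal_sup_ubound; exists n. Qed.

(** The admissible [n] contain 0 and are closed downwards: if bounded they have a maximum, otherwise
    every [n] is admissible. *)
Lemma EsP (R : realType) (K L : complex) (f : smap K L) :
  (Es R f = +oo /\ forall n, Es_ge f n) \/
  exists2 n, Es R f = (n%:R)%:E & Es_ge f n.
Proof.
have [[N fN]|unb] := pselect (exists N, forall n, Es_ge f n -> (n <= N)%N).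
  right; have ex0 : exists n, `[< Es_ge f n >] by exists 0%N; apply/asboolP/Es_ge0.
  have bnd n : `[< Es_ge f n >] -> (n <= N)%N by move/asboolP; exact: fN.
  case: (ex_maxnP ex0 bnd) => n /asboolP fn nmax; exists n => //.
  apply/eqP; rewrite eq_le Es_ge_Es // andbT.
  apply: ge_ereal_sup => _ [k fk <-]; rewrite lee_fin ler_nat.
  exact/nmax/asboolP.
have fall n : Es_ge f n.
  apply: contrapT => fn; apply: unb; exists n => k fk.
  by rewrite leqNgt; apply/negP => /ltnW /Es_ge_le/(_ fk).
left; split=> //; apply/eqyP => x x0.
apply: le_trans (Es_ge_Es R (fall (Num.bound x))).
by rewrite lee_fin ltW // archi_boundP // ltW.
Qed.

Theorem proposition34 (R : realType) (K L M : complex)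
    (f : smap K L) (g : smap L M) :
  ((Es R g + 1) * (Es R f + 1) - 1 <= Es R (scomp g f))%E.
Proof.
have [[gfE _]|[k gfE gf_max]] := EsP R (scomp g f); first by rewrite gfE leey.
have gfP m n : Es_ge f m -> Es_ge g n -> ((n.+1 * m.+1).-1 <= k)%N.
  move=> fm gn; have := Es_ge_Es R (Es_ge_comp fm gn).
  by rewrite gfE lee_fin ler_nat.
(* Once the composite has finite value [k], both factors are finite: level [k.+1] for one and level
   0 for the other would give level [k.+1] for the composite. *)
have [[_ fall]|[m fE fm]] := EsP R f.
  by have := gfP _ _ (fall k.+1) (Es_ge0 g); rewrite mul1n ltnn.
have [[_ gall]|[n gE gn]] := EsP R g.
  by have := gfP _ _ (Es_ge0 f) (gall k.+1); rewrite muln1 ltnn.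
have addE1 p : (p%:R)%:E + 1 = (p.+1%:R)%:E :> \bar R by rewrite -natr1 EFinD.
rewrite gfE fE gE !addE1 -EFinM -natrM leeBlDr // addE1 lee_fin ler_nat.
by rewrite -[X in (X <= _)%N]prednK // ltnS; exact: gfP.
Qed.
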